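(* Let $\mathfrak{V}=(\mathfrak{V}_x,\mathfrak{V}_y)$ be the vector field on $\mathbb{R}^2$ given by $$\begin{aligned}\mathfrak{V}_x&=-\cos y+\sqrt{3}\sin\Big(\frac{x}{2}\Big)\sin\Big(\frac{\sqrt{3}y}{2}\Big)+\cos\Big(\frac{\sqrt{3}x}{2}\Big)\cos\Big(\frac{y}{2}\Big),\\ \mathfrak{V}_y&=-\cos x+\sqrt{3}\sin\Big(\frac{y}{2}\Big)\sin\Big(\frac{\sqrt{3}x}{2}\Big)+\cos\Big(\frac{\sqrt{3}y}{2}\Big)\cos\Big(\frac{x}{2}\Big).\end{aligned}$$ Let also $\mathfrak{Q}=(\mathfrak{Q}_x,\mathfrak{Q}_y)$ be the vector field on $\mathbb{R}^2$ given by $$\begin{aligned}\mathfrak{Q}_x={}&2\cos x+2\cos y+2x\sin y+2\sqrt{3}\sin\Big(\frac{\sqrt{3}x}{2}\Big)\sin\Big(\frac{y}{2}\Big)-x\cos\Big(\frac{\sqrt{3}x}{2}\Big)\sin\Big(\frac{y}{2}\Big)\\&+\sqrt{3}y\sin\Big(\frac{\sqrt{3}x}{2}\Big)\cos\Big(\frac{y}{2}\Big)-2\cos\Big(\frac{x}{2}\Big)\cos\Big(\frac{\sqrt{3}y}{2}\Big)+\sqrt{3}y\cos\Big(\frac{x}{2}\Big)\sin\Big(\frac{\sqrt{3}y}{2}\Big)\\&-2\sqrt{3}\sin\Big(\frac{x}{2}\Big)\sin\Big(\frac{\sqrt{3}y}{2}\Big)-3x\sin\Big(\frac{x}{2}\Big)\cos\Big(\frac{\sqrt{3}y}{2}\Big)-2\cos\Big(\frac{\sqrt{3}x}{2}\Big)\cos\Big(\frac{y}{2}\Big),\end{aligned}$$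 and $\mathfrak{Q}_y(x,y)=\mathfrak{Q}_x(y,x)$. Then: 1) The vector field $\mathfrak{V}$ has a dihedral symmetry of order $6$: for any $\zeta\in\mathbb{D}_3$, one has $\zeta^{-1}\circ\mathfrak{V}\circ\zeta=\mathfrak{V}$. 2) The Taylor series of $\mathfrak{V}$ at the origin contains only terms of even total degree, and $\mathfrak{V}$ satisfies the vector Helmholtz equation and is solenoidal: $$\nabla^2\mathfrak{V}=-\mathfrak{V},\qquad \nabla\cdot\mathfrak{V}=0;$$ both of these properties (the Helmholtz equation and solenoidality) hold for $\mathfrak{Q}$ too. 3) The Taylor series at the origin of $\mathfrak{V}$ and $\mathfrak{Q}$ start from the degree $2$ homogeneous vector fields $\frac{3}{8}\mathbf{M}$ and $\frac{3}{2}\mathbf{M}$, respectively (that is, these are their lowest-degree nonzero homogeneous parts), where $$\mathbf{M}=(2xy-x^2+y^2,\;2xy+x^2-y^2).$$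
   Context: $\mathbb{D}_3$ denotes the dihedral group of order $6$, realized as the subgroup of $\mathrm{GL}(2,\mathbb{R})$ generated by $$\alpha=\frac12\begin{pmatrix}-1&-\sqrt{3}\\ \sqrt{3}&-1\end{pmatrix},\qquad \beta=\begin{pmatrix}0&1\\1&0\end{pmatrix},$$ acting on column vectors $(x,y)^T$. Vector fields on $\mathbb{R}^2$ are regarded as maps $\mathbb{R}^2\to\mathbb{R}^2$, so that $\zeta^{-1}\circ\mathfrak{V}\circ\zeta$ is a composition of maps. The operator $\nabla^2=\partial_x^2+\partial_y^2$ acts coordinatewise, and $\nabla\cdot(F_x,F_y)=\partial_xF_x+\partial_yF_y$. *)

(* Defs.v *)
From HB Require Import structures.
From mathcomp Require Import all_boot all_order all_algebra.
From mathcomp Require Import all_classical all_reals all_analysis.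

Set Implicit Arguments.
Unset Strict Implicit.
Unset Printing Implicit Defensive.

Import Order.TTheory GRing.Theory Num.Theory.
Import numFieldNormedType.Exports.

Local Open Scope classical_set_scope.
Local Open Scope ring_scope.

Section Plane.
Variable R : realType.

Definition xcoord (p : 'cV[R]_2) : R := p 0 0.
Definition ycoord (p : 'cV[R]_2) : R := p 1 0.

Definition mkfield (Fx Fy : R -> R -> R) (p : 'cV[R]_2) : 'cV[R]_2 :=
  \col_(c < 2) if c == 0 then Fx (xcoord p) (ycoord p)
               else Fy (xcoord p) (ycoord p).

Definition component (F : 'cV[R]_2 -> 'cV[R]_2) (c : 'I_2) (p : 'cV[R]_2) : R :=
  F p c 0.

Definition partial (i : 'I_2) (f : 'cV[R]_2 -> R) (p : 'cV[R]_2) : R :=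
  'D_(delta_mx i 0) f p.

(* C^oo: every iterated partial derivative, of any order and in any order of
   differentiation, is Frechet differentiable everywhere. The operator ['D]
   is total, so the operators below only have their intended meaning under
   such a hypothesis. *)
Definition smooth (f : 'cV[R]_2 -> R) : Prop :=
  forall (s : seq 'I_2) (p : 'cV[R]_2), differentiable (foldr partial f s) p.

Definition smooth_field (F : 'cV[R]_2 -> 'cV[R]_2) : Prop :=
  forall c, smooth (component F c).

Definition laplacian (f : 'cV[R]_2 -> R) (p : 'cV[R]_2) : R :=
  \sum_(i < 2) partial i (partial i f) p.

Definition vector_laplacian (F : 'cV[R]_2 -> 'cV[R]_2) (p : 'cV[R]_2) :
    'cV[R]_2 :=
  \col_(c < 2) laplacian (component F c) p.

Definition divergence (F : 'cV[R]_2 -> 'cV[R]_2) (p : 'cV[R]_2) : R :=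
  \sum_(i < 2) partial i (component F i) p.

Definition vector_helmholtz (F : 'cV[R]_2 -> 'cV[R]_2) : Prop :=
  forall p, vector_laplacian F p = - F p.

Definition solenoidal (F : 'cV[R]_2 -> 'cV[R]_2) : Prop :=
  forall p, divergence F p = 0.

(* Coefficient of x^i y^j in the Taylor series of f at the origin. *)
Definition taylor_coef (f : 'cV[R]_2 -> R) (i j : nat) : R :=
  iter i (partial 0) (iter j (partial 1) f) 0 / (i`!%:R * j`!%:R).

Definition taylor_even (F : 'cV[R]_2 -> 'cV[R]_2) : Prop :=
  forall (c : 'I_2) (i j : nat),
    odd (i + j) -> taylor_coef (component F c) i j = 0.

(* Homogeneous part of degree k of the Taylor series of F at the origin. *)
Definition taylor_part (F : 'cV[R]_2 -> 'cV[R]_2) (k : nat) (p : 'cV[R]_2) :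
    'cV[R]_2 :=
  \col_(c < 2) \sum_(i < k.+1)
    taylor_coef (component F c) i (k - i) * xcoord p ^+ i * ycoord p ^+ (k - i).

Definition taylor_starts_with (F : 'cV[R]_2 -> 'cV[R]_2) (k : nat)
    (H : 'cV[R]_2 -> 'cV[R]_2) : Prop :=
  [/\ forall j, (j < k)%N -> forall p, taylor_part F j p = 0,
      forall p, taylor_part F k p = H p
    & exists p, H p != 0].

(* GL(2, R) is infinite, so its subgroups are sets of invertible matrices
   rather than [{group _}]. *)
Definition subgroup_GL2 (G : set 'M[R]_2) : Prop :=
  [/\ forall A, G A -> A \in unitmx,
      G 1%:M,
      forall A B, G A -> G B -> G (A *m B)
    & forall A, G A -> G (invmx A)].

Definition alpha : 'M[R]_2 :=
  \matrix_(i < 2, j < 2)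
    (2^-1 * (if i == j then -1
             else if i == 0 then - Num.sqrt 3 else Num.sqrt 3)).

Definition beta : 'M[R]_2 := \matrix_(i < 2, j < 2) (i != j)%:R.

Definition D3 : set 'M[R]_2 := smallest subgroup_GL2 [set alpha; beta].

Local Notation s3 := (Num.sqrt 3 : R).

Definition Vx (x y : R) : R :=
  - cos y + s3 * sin (x / 2) * sin (s3 * y / 2)
  + cos (s3 * x / 2) * cos (y / 2).

Definition Vy (x y : R) : R :=
  - cos x + s3 * sin (y / 2) * sin (s3 * x / 2)
  + cos (s3 * y / 2) * cos (x / 2).

Definition V : 'cV[R]_2 -> 'cV[R]_2 := mkfield Vx Vy.

Definition Qx (x y : R) : R :=
  2 * cos x + 2 * cos y + 2 * x * sin y
  + 2 * s3 * sin (s3 * x / 2) * sin (y / 2)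
  - x * cos (s3 * x / 2) * sin (y / 2)
  + s3 * y * sin (s3 * x / 2) * cos (y / 2)
  - 2 * cos (x / 2) * cos (s3 * y / 2)
  + s3 * y * cos (x / 2) * sin (s3 * y / 2)
  - 2 * s3 * sin (x / 2) * sin (s3 * y / 2)
  - 3 * x * sin (x / 2) * cos (s3 * y / 2)
  - 2 * cos (s3 * x / 2) * cos (y / 2).

Definition Qy (x y : R) : R := Qx y x.

Definition Q : 'cV[R]_2 -> 'cV[R]_2 := mkfield Qx Qy.

Definition M : 'cV[R]_2 -> 'cV[R]_2 :=
  mkfield (fun x y => 2 * x * y - x ^+ 2 + y ^+ 2)
          (fun x y => 2 * x * y + x ^+ 2 - y ^+ 2).

End Plane.

Arguments alpha R : clear implicits.
Arguments beta R : clear implicits.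
Arguments D3 R _ : clear implicits.
Arguments V R _ : clear implicits.
Arguments Q R _ : clear implicits.
Arguments M R _ : clear implicits.

(* Main.v *)
(** Product-to-sum formulas turn every component into a finite sum of plane
    waves [A(p) cos (k.p) + B(p) sin (k.p)] with [|k| = 1] and [A], [B] affine;
    such sums are stable under partial derivatives, which gives smoothness.
    Each wave in [V] has constant [A] and no sine part, whence the even Taylor
    series. A wave satisfies the Helmholtz equation as soon as [|k| = 1] and
    [k] is orthogonal to the gradients of [A] and [B]. The matrices commuting
    with [V] form a subgroup, so the symmetry is checked on [alpha], [beta]. *)

Require Import Defs.
From HB Require Import structures.
From mathcomp Require Import all_boot all_order all_algebra.
From mathcomp Require Import all_classical all_reals all_analysis.
From mathcomp Require Import ring.
Set Implicit Arguments.
Unset Strict Implicit.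
Unset Printing Implicit Defensive.

Import Order.TTheory GRing.Theory Num.Theory.
Import numFieldNormedType.Exports.
Local Open Scope ring_scope.

Lemma sum_ord2 (T : nmodType) (F : 'I_2 -> T) : \sum_(i < 2) F i = F 0 + F 1.
Proof.
by rewrite big_ord_recl big_ord1; congr (F _ + F _); apply: val_inj.
Qed.

(** * Differentiability and partial derivatives of scalar functions on the plane *)

Section Gradient.
Variable R : realType.
Implicit Types (f g : 'cV[R]_2 -> R) (p : 'cV[R]_2) (u v : 'I_2 -> R).

(** Differentiability travels with the values because [partial] is total and its value alone
    certifies nothing. *)
Definition has_gradient f p u :=
  differentiable f p /\ forall i, partial i f p = u i.

Lemma has_gradient_eq f p u v :
  has_gradient f p u -> u =1 v -> has_gradient f p v.
Proof. by move=> [df pf] uv; split=> // i; rewrite pf uv. Qed.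

Lemma has_gradient_cst (a : R) p : has_gradient (fun=> a) p (fun=> 0).
Proof.
split; first exact: differentiable_cst.
by move=> i; rewrite /partial derive_cst.
Qed.

Lemma has_gradient_coord (j : 'I_2) p :
  has_gradient (fun q : 'cV[R]_2 => q j 0) p (fun i => (i == j)%:R).
Proof.
split; first exact: differentiable_coord.
move=> i; rewrite /partial deriveE; last exact: differentiable_coord.
(* Packaged as a linear map, the coordinate function is its own differential. *)
have @c : {linear 'cV[R]_2 -> R}.
  by exists (fun q : 'cV[R]_2 => q j 0); do 2![eexists]; do ?[constructor];
     rewrite ?mxE// => ? *; rewrite ?mxE//; move=> ?; rewrite !mxE.
rewrite (_ : (fun _ => _) = c) // diff_lin; last exact: coord_continuous.
by rewrite /= mxE eqxx andbT eq_sym.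
Qed.

Lemma has_gradientD f g p u v : has_gradient f p u -> has_gradient g p v ->
  has_gradient (fun q => f q + g q) p (fun i => u i + v i).
Proof.
move=> [df pf] [dg pg]; split; first exact: differentiableD.
by move=> i; rewrite -pf -pg /partial -deriveD //; apply: diff_derivable.
Qed.

Lemma has_gradientM f g p u v : has_gradient f p u -> has_gradient g p v ->
  has_gradient (fun q => f q * g q) p (fun i => f p * v i + g p * u i).
Proof.
move=> [df pf] [dg pg]; split; first exact: differentiableM.
by move=> i; rewrite -pf -pg /partial; apply: deriveM; apply: diff_derivable.
Qed.

Lemma has_gradient_comp (h : R -> R) (dh : R) f p u :
  has_gradient f p u -> is_derive (f p) 1 h dh ->
  has_gradient (fun q => h (f q)) p (fun i => dh * u i).
Proof.
move=> [df pf] [/derivable1_diffP ddh hdh].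
have dhf : differentiable (h \o f) p by exact: differentiable_comp.
split=> // i; rewrite /partial (_ : (fun _ => _) = h \o f) // deriveE //.
rewrite diff_comp //= diff1E // derive1E hdh -deriveE //.
by rewrite -/(partial i f p) pf mulrC.
Qed.

End Gradient.

(** * Plane waves with affine amplitudes *)

Section Wave.
Variable R : realType.
Implicit Types (p : 'cV[R]_2) (i j : 'I_2) (k a : 'I_2 -> R).

Definition dot k p : R := k 0 * xcoord p + k 1 * ycoord p.

(** Storing waves by their coefficients turns differentiation into an algebraic operation that can
    be iterated symbolically. *)
Record wave := Wave {
  wvec : 'I_2 -> R;
  camp0 : R; camp1 : 'I_2 -> R;
  samp0 : R; samp1 : 'I_2 -> R }.
Implicit Types (t : wave) (l : seq wave).

Definition wval t p : R :=
  (camp0 t + dot (camp1 t) p) * cos (dot (wvec t) p) +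
  (samp0 t + dot (samp1 t) p) * sin (dot (wvec t) p).

(** Product rule: the derivative of an amplitude keeps its trigonometric factor, while that of the
    factor swaps cosine and sine. *)
Definition wpartial i t : wave :=
  Wave (wvec t)
    (camp1 t i + wvec t i * samp0 t) (fun j => wvec t i * samp1 t j)
    (samp1 t i - wvec t i * camp0 t) (fun j => - (wvec t i * camp1 t j)).

Definition wsum l p : R := \sum_(t <- l) wval t p.


Lemma has_gradient_dot k p : has_gradient (dot k) p k.
Proof.
apply: has_gradient_eq.
  apply: has_gradientD; apply: has_gradientM;
    solve [exact: has_gradient_cst | exact: has_gradient_coord].
move=> i /=; rewrite !mulr0 !addr0.
by case: i => [[|[|//]]] ?; rewrite ?mulr1 ?mulr0 ?addr0 ?add0r;
  congr k; apply: val_inj.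
Qed.

Lemma has_gradient_wval t p :
  has_gradient (wval t) p (fun i => wval (wpartial i t) p).
Proof.
have amp (c : R) a : has_gradient (fun q => c + dot a q) p a.
  apply: has_gradient_eq.
    apply: has_gradientD; [exact: has_gradient_cst|exact: has_gradient_dot].
  by move=> i; rewrite /= add0r.
apply: has_gradient_eq.
  by apply: has_gradientD; apply: has_gradientM; try exact: amp;
    apply: has_gradient_comp; exact: has_gradient_dot.
by move=> i; rewrite /wval /dot /=; ring.
Qed.

Lemma has_gradient_wsum l p :
  has_gradient (wsum l) p (fun i => wsum (map (wpartial i) l) p).
Proof.
elim: l => [|t l IHl].
  rewrite (_ : wsum [::] = fun=> 0); last first.
    by apply/funext => q; rewrite /wsum big_nil.
  apply: has_gradient_eq; first exact: has_gradient_cst.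
  by [].
rewrite (_ : wsum (t :: l) = fun q => wval t q + wsum l q); last first.
  by apply/funext => q; rewrite /wsum big_cons.
apply: has_gradient_eq; first exact/has_gradientD/IHl/has_gradient_wval.
by move=> i; rewrite /wsum big_cons.
Qed.

Lemma partial_wsum i l : partial i (wsum l) = wsum (map (wpartial i) l).
Proof. by apply/funext => p; have [_ ->] := has_gradient_wsum l p. Qed.

Lemma smooth_wsum l : smooth (wsum l).
Proof.
move=> s p; suff [l' ->] : exists l', foldr (@partial R) (wsum l) s = wsum l'.
  by have [] := has_gradient_wsum l' p.
elim: s => [|i s [l' IHs]] /=; first by exists l.
by exists (map (wpartial i) l'); rewrite IHs partial_wsum.
Qed.

(** * The Helmholtz equation for waves *)

Definition helmholtz_wave t : Prop :=
  [/\ wvec t 0 ^+ 2 + wvec t 1 ^+ 2 = 1,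
      wvec t 0 * camp1 t 0 + wvec t 1 * camp1 t 1 = 0 &
      wvec t 0 * samp1 t 0 + wvec t 1 * samp1 t 1 = 0].

Lemma helmholtz_wval t p : helmholtz_wave t ->
  wval (wpartial 0 (wpartial 0 t)) p + wval (wpartial 1 (wpartial 1 t)) p
  = - wval t p.
Proof.
case=> k1 ka kb; rewrite /wval /dot /=.
set c := cos _; set s := sin _.
(* Affine amplitudes are harmonic, so only the cross terms with their gradients and the factor
   $-|k|^2$ remain. *)
transitivity (2 * (wvec t 0 * samp1 t 0 + wvec t 1 * samp1 t 1) * c
  - 2 * (wvec t 0 * camp1 t 0 + wvec t 1 * camp1 t 1) * s
  - (wvec t 0 ^+ 2 + wvec t 1 ^+ 2) * wval t p).
  by rewrite /wval -/c -/s /dot; ring.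
by rewrite k1 ka kb !mulr0 !mul0r subrr sub0r mul1r.
Qed.

(** On an explicit list this computes to a conjunction, which can be split directly. *)
Definition all_waves (P : wave -> Prop) l : Prop :=
  foldr (fun t Pl => P t /\ Pl) True l.

Lemma laplacian_wsum l p : all_waves helmholtz_wave l ->
  laplacian (wsum l) p = - wsum l p.
Proof.
rewrite /laplacian sum_ord2 !partial_wsum /wsum !big_map -big_split /=.
elim: l => [|t l IHl] /=; first by rewrite !big_nil oppr0.
by case=> ht hl; rewrite !big_cons (IHl hl) (helmholtz_wval p ht) [RHS]opprD.
Qed.

(** * Parity of waves and Taylor coefficients at the origin *)

Definition pure_cos t : Prop :=
  [/\ camp1 t = (fun=> 0), samp0 t = 0 & samp1 t = (fun=> 0)].
Definition pure_sin t : Prop :=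
  [/\ camp1 t = (fun=> 0), camp0 t = 0 & samp1 t = (fun=> 0)].
Definition parity (b : bool) t : Prop := if b then pure_sin t else pure_cos t.

Lemma parity_wpartial (b : bool) i t : parity b t -> parity (~~ b) (wpartial i t).
Proof.
by case: b => -[a1 a2 a3]; split; rewrite /= ?a1 ?a2 ?a3 ?mulr0 ?addr0 ?subr0 //;
  apply/funext => j; rewrite ?mulr0 ?oppr0.
Qed.

Lemma all_waves_parity_partial (b : bool) i l : all_waves (parity b) l ->
  all_waves (parity (~~ b)) (map (wpartial i) l).
Proof.
by elim: l => //= t l IHl [ht /IHl hl]; split=> //; exact: parity_wpartial.
Qed.

(** Sines and the linear parts of the amplitudes vanish at the origin. *)
Lemma wsum0 l : wsum l 0 = \sum_(t <- l) camp0 t.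
Proof.
apply: eq_bigr => t _; rewrite /wval /dot /xcoord /ycoord !mxE.
by rewrite !mulr0 !addr0 cos0 sin0 mulr1 mulr0 addr0.
Qed.

Lemma taylor_coef_wsum l (i j : nat) :
  taylor_coef (wsum l) i j =
  wsum (iter i (map (wpartial 0)) (iter j (map (wpartial 1)) l)) 0 /
  (i`!%:R * j`!%:R).
Proof.
have it (c : 'I_2) n l' :
    iter n (partial c) (wsum l') = wsum (iter n (map (wpartial c)) l').
  by elim: n => //= n ->; rewrite partial_wsum.
by rewrite /taylor_coef !it.
Qed.

(** An odd number of derivatives turns pure cosines into pure sines, which vanish at the origin. *)
Lemma taylor_coef_odd l (i j : nat) : all_waves pure_cos l -> odd (i + j) ->
  taylor_coef (wsum l) i j = 0.
Proof.
move=> hl oij; rewrite taylor_coef_wsum wsum0.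
have it (c : 'I_2) n b l' : all_waves (parity b) l' ->
    all_waves (parity (odd n (+) b)) (iter n (map (wpartial c)) l').
  by elim: n => //= n IHn /IHn/(all_waves_parity_partial c); rewrite addNb.
have := it 0 i _ _ (it 1 j false l hl).
rewrite addbF -oddD oij.
elim: (iter _ _ _) => [|t l' IHl] /=; first by rewrite big_nil mul0r.
case=> -[_ t0 _] /IHl; rewrite big_cons t0 add0r; exact.
Qed.

End Wave.

(** * Wave decompositions of [V] and [Q] *)

Section Fields.
Variable R : realType.
Implicit Types (p : 'cV[R]_2) (c : 'I_2).

Local Notation s3 := (Num.sqrt 3 : R).

(* The second component of [V] and [Q] is the first one with the coordinates
   exchanged, so the waves of component [c] have their first coordinate along
   axis [c]. *)
Definition vec2 c (u v : R) : 'I_2 -> R := fun i => if i == c then u else v.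

(** Triples of wave vector and cosine amplitude: first [- cos y], then the two waves of the product
    of sines, then those of the product of cosines. *)
Definition V_waves c : seq (wave R) :=
  [seq Wave (vec2 c uvw.1.1 uvw.1.2) uvw.2 (fun=> 0) 0 (fun=> 0) |
    uvw <- [:: (0, 1, - 1); (1 / 2, s3 / 2, - s3 / 2);
               (1 / 2, - s3 / 2, s3 / 2);
               (s3 / 2, 1 / 2, 1 / 2); (s3 / 2, - 1 / 2, 1 / 2)]].

(** The terms of [Qx] with a factor [x] or [y] give the linear sine amplitudes, the others the
    constant cosine amplitudes. *)
Definition Q_waves c : seq (wave R) :=
  let w u v a b b' := Wave (vec2 c u v) a (fun=> 0) 0 (vec2 c b b') in
  [:: w 1 0 2 0 0; w 0 1 2 2 0;
      w (s3 / 2) (1 / 2) (- s3 - 1) (- 1 / 2) (s3 / 2);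
      w (s3 / 2) (- 1 / 2) (s3 - 1) (1 / 2) (s3 / 2);
      w (1 / 2) (s3 / 2) (s3 - 1) (- 3 / 2) (s3 / 2);
      w (1 / 2) (- s3 / 2) (- s3 - 1) (- 3 / 2) (- s3 / 2)].

Lemma sqr_sqrt3 : s3 ^+ 2 = 3.
Proof. by rewrite sqr_sqrtr // ler0n. Qed.

Lemma ord2P (P : 'I_2 -> Prop) : P 0 -> P 1 -> forall c, P c.
Proof.
move=> P0 P1 [[|[|//]] lt_c]; [have -> : Ordinal lt_c = 0 by apply: val_inj|
  have -> : Ordinal lt_c = 1 by apply: val_inj]; done.
Qed.

Lemma dot_vec2 c u v p : dot (vec2 c u v) p = u * p c 0 + v * p (rev_ord c) 0.
Proof.
rewrite /dot /vec2 /xcoord /ycoord.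
elim/ord2P: c.
  by congr (_ + _ * p _ 0); apply: val_inj.
by rewrite /= addrC; congr (_ + _ * p _ 0); apply: val_inj.
Qed.

Lemma component_mkfield (F : R -> R -> R) c p :
  component (mkfield F (fun x y => F y x)) c p = F (p c 0) (p (rev_ord c) 0).
Proof.
rewrite /component mxE; elim/ord2P: c => /=; congr (F (p _ 0) (p _ 0));
  exact: val_inj.
Qed.

Lemma component_V c : component (V R) c = wsum (V_waves c).
Proof.
apply/funext => p; rewrite (component_mkfield (@Vx R)).
rewrite /wsum /V_waves !big_cons big_nil /wval /= !dot_vec2.
set x := p c 0; set y := p _ 0.
(* Phases are written as sums or differences of the arguments in [Vx], so that the addition formulas
   recover its products. *)
have -> : 0 * x + 1 * y = y by ring.
have -> : 1 / 2 * x + s3 / 2 * y = x / 2 + s3 * y / 2 by ring.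
have -> : 1 / 2 * x + - s3 / 2 * y = x / 2 - s3 * y / 2 by ring.
have -> : s3 / 2 * x + 1 / 2 * y = s3 * x / 2 + y / 2 by ring.
have -> : s3 / 2 * x + - 1 / 2 * y = s3 * x / 2 - y / 2 by ring.
rewrite /Vx !(cosB, cosD) /dot; by field.
Qed.

Lemma component_Q c : component (Q R) c = wsum (Q_waves c).
Proof.
apply/funext => p; rewrite (component_mkfield (@Qx R)).
rewrite /wsum /Q_waves !big_cons big_nil /wval /= !dot_vec2.
set x := p c 0; set y := p _ 0.
have -> : 1 * x + 0 * y = x by ring.
have -> : 0 * x + 1 * y = y by ring.
have -> : 1 / 2 * x + s3 / 2 * y = x / 2 + s3 * y / 2 by ring.
have -> : 1 / 2 * x + - s3 / 2 * y = x / 2 - s3 * y / 2 by ring.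
have -> : s3 / 2 * x + 1 / 2 * y = s3 * x / 2 + y / 2 by ring.
have -> : s3 / 2 * x + - 1 / 2 * y = s3 * x / 2 - y / 2 by ring.
rewrite /Qx !(cosB, cosD, sinB, sinD) /dot; by field.
Qed.

(** * Smoothness, Helmholtz equation and solenoidality *)

Lemma V_smooth : smooth_field (V R).
Proof. by move=> c; rewrite component_V; exact: smooth_wsum. Qed.

Lemma Q_smooth : smooth_field (Q R).
Proof. by move=> c; rewrite component_Q; exact: smooth_wsum. Qed.

Lemma vector_helmholtz_wsum (F : 'cV[R]_2 -> 'cV[R]_2) (w : 'I_2 -> seq (wave R)) :
  (forall c, component F c = wsum (w c)) ->
  (forall c, all_waves (@helmholtz_wave R) (w c)) -> vector_helmholtz F.
Proof.
move=> Fw hw p; apply/colP => c.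
by rewrite !mxE Fw laplacian_wsum // -Fw.
Qed.

Lemma V_helmholtz : vector_helmholtz (V R).
Proof.
apply: (vector_helmholtz_wsum component_V) => c.
have s := sqr_sqrt3.
by elim/ord2P: c; do !split; rewrite /= /vec2 /=; field: s.
Qed.

(** Each linear sine amplitude has its gradient orthogonal to the wave vector, as $(-1/2, \sqrt3/2)$
    is to $(\sqrt3/2, 1/2)$. *)
Lemma Q_helmholtz : vector_helmholtz (Q R).
Proof.
apply: (vector_helmholtz_wsum component_Q) => c.
have s := sqr_sqrt3.
by elim/ord2P: c; do !split; rewrite /= /vec2 /=; field: s.
Qed.

Lemma divergence_wsum (F : 'cV[R]_2 -> 'cV[R]_2) (w : 'I_2 -> seq (wave R)) p :
  (forall c, component F c = wsum (w c)) ->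
  divergence F p = wsum (map (wpartial 0) (w 0) ++ map (wpartial 1) (w 1)) p.
Proof.
by move=> Fw; rewrite /divergence sum_ord2 !Fw !partial_wsum /wsum big_cat.
Qed.

Ltac expand_trig :=
  rewrite /vec2 /dot /= !(mulNr, mul0r, mul1r, add0r, addr0);
  rewrite !(cosB, cosD, sinB, sinD, cosN, sinN).

(** Each wave of $\partial_x V_x$ cancels one of $\partial_y V_y$ with the same phase up to sign;
    expanding the phases exposes this to [field]. *)
Lemma V_solenoidal : solenoidal (V R).
Proof.
move=> p; rewrite (divergence_wsum p component_V) /wsum /V_waves /=.
rewrite !big_cons big_nil /wval; expand_trig.
by field.
Qed.

Lemma Q_solenoidal : solenoidal (Q R).
Proof.
move=> p; rewrite (divergence_wsum p component_Q) /wsum /Q_waves /=.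
rewrite !big_cons big_nil /wval; expand_trig.
have s := sqr_sqrt3.
by field: s.
Qed.

(** * Taylor series of the two fields *)

Lemma V_taylor_even : taylor_even (V R).
Proof.
by move=> c i j; rewrite component_V; apply: taylor_coef_odd; do !split.
Qed.

(** Taylor coefficients are sums of cosine constants of differentiated waves, so orders up to two
    become finite computations; the halves come from [2!]. *)
Lemma taylor_starts_with2 (F H : 'cV[R]_2 -> 'cV[R]_2)
    (w : 'I_2 -> seq (wave R)) :
  let D c (i j : nat) := \sum_(t <- iter i (map (wpartial 0))
                                     (iter j (map (wpartial 1)) (w c))) camp0 t in
  (forall c, component F c = wsum (w c)) ->
  (forall c, [/\ D c 0 0 = 0, D c 0 1 = 0 & D c 1 0 = 0]) ->
  (forall c p, D c 0 2 / 2 * ycoord p ^+ 2 + D c 1 1 * xcoord p * ycoord p +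
               D c 2 0 / 2 * xcoord p ^+ 2 = H p c 0) ->
  (exists p, H p != 0) ->
  taylor_starts_with F 2 H.
Proof.
move=> D Fw D01 D2 H0.
have coef c i j : taylor_coef (component F c) i j = D c i j / (i`!%:R * j`!%:R).
  by rewrite Fw taylor_coef_wsum wsum0.
clearbody D.
split=> // [[|[|//]] _ p|p]; apply/colP => c;
  rewrite !mxE !big_ord_recl big_ord0 !coef.
- by have [-> _ _] := D01 c; rewrite !mul0r addr0.
- have [_ D1 D2'] := D01 c.
  by rewrite [D c _ _]D1 [D c _ _]D2' !mul0r !addr0.
- rewrite -D2 /= /bump /= !subn0 !expr0 !expr1.
  by rewrite fact0 (_ : 1`! = 1%N) // (_ : 2`! = 2%N) // !mulr1 !mul1r !divr1 addr0 addrA.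
Qed.

Lemma M_neq0 (a : R) : a != 0 -> exists p, a *: M R p != 0.
Proof.
(* At $(1,0)$ the first component of [M] is $-1$. *)
move=> a0; exists (delta_mx 0 0); rewrite scaler_eq0 negb_or a0 /=.
apply/eqP => /colP/(_ 0); rewrite !mxE /xcoord /ycoord !mxE /=.
by rewrite mulr0 expr0n expr1n addr0 sub0r => /eqP; rewrite oppr_eq0 oner_eq0.
Qed.

Ltac compute_derivatives :=
  rewrite /V_waves /Q_waves /= !big_cons big_nil /vec2 /=.

Lemma V_taylor_starts : taylor_starts_with (V R) 2 (fun p => (3 / 8) *: M R p).
Proof.
have s := sqr_sqrt3.
apply: (taylor_starts_with2 component_V).
- by elim/ord2P; split; compute_derivatives; field: s.
- by elim/ord2P => p; rewrite !mxE; compute_derivatives; field: s.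
- by apply: M_neq0; rewrite mulf_neq0 ?invr_neq0 ?pnatr_eq0.
Qed.

Lemma Q_taylor_starts : taylor_starts_with (Q R) 2 (fun p => (3 / 2) *: M R p).
Proof.
have s := sqr_sqrt3.
apply: (taylor_starts_with2 component_Q).
- by elim/ord2P; split; compute_derivatives; field: s.
- by elim/ord2P => p; rewrite !mxE; compute_derivatives; field: s.
- by apply: M_neq0; rewrite mulf_neq0 ?invr_neq0 ?pnatr_eq0.
Qed.

(** * Dihedral symmetry of [V] *)

Lemma VxE x y : Vx x y = - cos y
  + s3 / 2 * (cos (x / 2 - s3 * y / 2) - cos (x / 2 + s3 * y / 2))
  + 1 / 2 * (cos (s3 * x / 2 + y / 2) + cos (s3 * x / 2 - y / 2)).
Proof. by rewrite /Vx !(cosB, cosD); field. Qed.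

Lemma V_colE c p : V R p c 0 = Vx (p c 0) (p (rev_ord c) 0).
Proof. exact: component_mkfield. Qed.

(** Rotation by 120 degrees permutes, up to sign, the six phases occurring in the two components. *)
Lemma V_alpha p : V R (alpha R *m p) = alpha R *m V R p.
Proof.
have s := sqr_sqrt3.
have r0 : rev_ord 0 = 1 :> 'I_2 by apply: val_inj.
have r1 : rev_ord 1 = 0 :> 'I_2 by apply: val_inj.
apply/colP => c; rewrite [RHS]mxE sum_ord2 !V_colE !mxE !sum_ord2 r0 r1.
elim/ord2P: c; rewrite ?r0 ?r1 !mxE /=; set x := p 0 0; set y := p 1 0.
- set x' := 2^-1 * -1 * x + 2^-1 * - s3 * y.
  set y' := 2^-1 * s3 * x + 2^-1 * -1 * y.
  rewrite !VxE.
  (* Each rotated phase is identified with plus or minus an original one; [cosN] then removes the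
     signs. *)
  have -> : y' = s3 * x / 2 - y / 2 by rewrite /y'; field.
  have -> : x' = - (x / 2 + s3 * y / 2) by rewrite /x'; field.
  have -> : - (x / 2 + s3 * y / 2) / 2 - s3 * (s3 * x / 2 - y / 2) / 2 = - x.
    by field: s.
  have -> : - (x / 2 + s3 * y / 2) / 2 + s3 * (s3 * x / 2 - y / 2) / 2
    = x / 2 - s3 * y / 2 by field: s.
  have -> : s3 * - (x / 2 + s3 * y / 2) / 2 + (s3 * x / 2 - y / 2) / 2 = - y.
    by field: s.
  have -> : s3 * - (x / 2 + s3 * y / 2) / 2 - (s3 * x / 2 - y / 2) / 2
    = - (s3 * x / 2 + y / 2) by field: s.
  rewrite !cosN !(cosB, cosD); by field: s.
- set x' := 2^-1 * -1 * x + 2^-1 * - s3 * y.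
  set y' := 2^-1 * s3 * x + 2^-1 * -1 * y.
  rewrite !VxE.
  have -> : y' = s3 * x / 2 - y / 2 by rewrite /y'; field.
  have -> : x' = - (x / 2 + s3 * y / 2) by rewrite /x'; field.
  have -> : (s3 * x / 2 - y / 2) / 2 - s3 * - (x / 2 + s3 * y / 2) / 2
    = s3 * x / 2 + y / 2 by field: s.
  have -> : (s3 * x / 2 - y / 2) / 2 + s3 * - (x / 2 + s3 * y / 2) / 2 = - y.
    by field: s.
  have -> : s3 * (s3 * x / 2 - y / 2) / 2 + - (x / 2 + s3 * y / 2) / 2
    = x / 2 - s3 * y / 2 by field: s.
  have -> : s3 * (s3 * x / 2 - y / 2) / 2 - - (x / 2 + s3 * y / 2) / 2 = x.
    by field: s.
  rewrite !cosN !(cosB, cosD); by field: s.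
Qed.

(** Swapping the coordinates exchanges the components, since [Vy x y] is [Vx y x]. *)
Lemma V_beta p : V R (beta R *m p) = beta R *m V R p.
Proof.
apply/colP => c; rewrite [RHS]mxE sum_ord2 !V_colE !mxE !sum_ord2 !mxE.
by elim/ord2P: c; rewrite /= !(mul0r, mul1r, add0r, addr0); congr Vx;
  congr (p _ 0); apply: val_inj.
Qed.

Lemma alpha_unit : alpha R \in unitmx.
Proof.
have s := sqr_sqrt3.
(* A rotation is orthogonal, so its transpose is its inverse. *)
apply: (proj1 (mulmx1_unit (B := (alpha R)^T) _)).
apply/matrixP => i j; rewrite !mxE sum_ord2 !mxE.
by elim/ord2P: i; elim/ord2P: j; rewrite /=; field: s.
Qed.

Lemma beta_unit : beta R \in unitmx.
Proof.
apply: (proj1 (mulmx1_unit (B := beta R) _)).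
apply/matrixP => i j; rewrite !mxE sum_ord2 !mxE.
by elim/ord2P: i; elim/ord2P: j; rewrite /= !(mul0r, mul1r, add0r, addr0).
Qed.

Lemma subgroup_equivariant (F : 'cV[R]_2 -> 'cV[R]_2) :
  subgroup_GL2 (fun A => A \in unitmx /\ forall p, F (A *m p) = A *m F p).
Proof.
split.
- by move=> A [].
- by split=> [|p]; rewrite ?unitmx1 // !mul1mx.
- move=> A B [uA FA] [uB FB]; split=> [|p]; first by rewrite unitmx_mul uA.
  by rewrite -!mulmxA FA FB.
- move=> A [uA FA]; split=> [|p]; first by rewrite unitmx_inv.
  (* $F(A^{-1}p) = A^{-1}A\,F(A^{-1}p) = A^{-1}F(p)$. *)
  by rewrite -[LHS](mulKmx uA) -FA mulKVmx.
Qed.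

Lemma V_D3 zeta : D3 R zeta -> mulmx (invmx zeta) \o V R \o mulmx zeta = V R.
Proof.
move=> Dz.
have [uz Vz] : zeta \in unitmx /\ forall p, V R (zeta *m p) = zeta *m V R p.
  (* By minimality [D3] lies in the subgroup of equivariant matrices once both generators do. *)
  apply: (smallest_sub (subgroup_equivariant (V R)) _ Dz) => _ [->|->].
    by split; [exact: alpha_unit | exact: V_alpha].
  by split; [exact: beta_unit | exact: V_beta].
by apply/funext => p /=; rewrite Vz mulKmx.
Qed.

End Fields.

Theorem theorem3 (R : realType) :
  (smooth_field (V R) /\ smooth_field (Q R)) /\
  (forall zeta : 'M[R]_2, D3 R zeta ->
     mulmx (invmx zeta) \o V R \o mulmx zeta = V R) /\
  (taylor_even (V R) /\
   (vector_helmholtz (V R) /\ solenoidal (V R)) /\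
   (vector_helmholtz (Q R) /\ solenoidal (Q R))) /\
  (taylor_starts_with (V R) 2 (fun p => (3 / 8) *: M R p) /\
   taylor_starts_with (Q R) 2 (fun p => (3 / 2) *: M R p)).
Proof.
split; first by split; [exact: V_smooth | exact: Q_smooth].
split; first exact: V_D3.
split; last by split; [exact: V_taylor_starts | exact: Q_taylor_starts].
split; first exact: V_taylor_even.
split; first by split; [exact: V_helmholtz | exact: V_solenoidal].
by split; [exact: Q_helmholtz | exact: Q_solenoidal].
Qed.
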